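(* Let $\lambda$ be a nonzero real number and let $x\in\mathbb{R}$. For every integer $n\ge 0$, $$D_{n,\lambda}(x)=\sum_{m=0}^{n}\beta_{m,\lambda}(x)\,S_{1,\lambda}(n,m).$$
   Context: Generating functions are power series in $t$ (formal, or convergent for $|t|$ small), with $(1+t)^{x}=\sum_{n\ge 0}(x)_n\frac{t^n}{n!}$, where $(x)_0=1$ and $(x)_n=x(x-1)\cdots(x-n+1)$ for $n\ge1$. Also $(x)_{0,\lambda}=1$ and $(x)_{n,\lambda}=x(x-\lambda)\cdots(x-(n-1)\lambda)$ for $n\ge 1$, and $(1+\lambda t)^{x/\lambda}=\sum_{n\ge0}(x)_{n,\lambda}\frac{t^n}{n!}$. The degenerate logarithm is $\log_\lambda(1+t)=\frac{1}{\lambda}\left((1+t)^\lambda-1\right)$. The degenerate Daehee polynomials $D_{n,\lambda}(x)$ are defined by $\frac{\log_\lambda(1+t)}{t}(1+t)^x=\sum_{n=0}^\infty D_{n,\lambda}(x)\frac{t^n}{n!}$. The degenerate Bernoulli polynomials $\beta_{n,\lambda}(x)$ are defined by $\frac{t}{(1+\lambda t)^{1/\lambda}-1}(1+\lambda t)^{x/\lambda}=\sum_{n=0}^\infty \beta_{n,\lambda}(x)\frac{t^n}{n!}$. The degenerate Stirling numbers of the first kind $S_{1,\lambda}(n,l)$ are defined by the polynomial identity in $x$: $(x)_n=\sum_{l=0}^n S_{1,\lambda}(n,l)(x)_{l,\lambda}$ for $n\ge0$. *)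

(* Defs.v *)
From HB Require Import structures.
From mathcomp Require Import all_boot all_order all_algebra.
From mathcomp Require Import boolp reals.

Set Implicit Arguments.
Unset Strict Implicit.
Unset Printing Implicit Defensive.

Import Order.TTheory GRing.Theory Num.Theory.
Local Open Scope ring_scope.

Record fps (F : fieldType) := Fps { fcoef : nat -> F }.

Section FpsRing.
Variable F : fieldType.
Implicit Types f g h : fps F.

Lemma fpsP f g : (forall n, fcoef f n = fcoef g n) <-> f = g.
Proof.
split=> [|-> //]; case: f g => [f] [g] /= fg; congr Fps.
exact: funext.
Qed.

HB.instance Definition _ := gen_eqMixin (fps F).
HB.instance Definition _ := gen_choiceMixin (fps F).

Definition fps_zero : fps F := Fps (fun=> 0).
Definition fps_opp f : fps F := Fps (fun n => - fcoef f n).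
Definition fps_add f g : fps F := Fps (fun n => fcoef f n + fcoef g n).

Fact fps_addA : associative fps_add.
Proof. by move=> f g h; apply/fpsP => n /=; rewrite addrA. Qed.
Fact fps_addC : commutative fps_add.
Proof. by move=> f g; apply/fpsP => n /=; rewrite addrC. Qed.
Fact fps_add0 : left_id fps_zero fps_add.
Proof. by move=> f; apply/fpsP => n /=; rewrite add0r. Qed.
Fact fps_addN : left_inverse fps_zero fps_opp fps_add.
Proof. by move=> f; apply/fpsP => n /=; rewrite addNr. Qed.

HB.instance Definition _ :=
  GRing.isZmodule.Build (fps F) fps_addA fps_addC fps_add0 fps_addN.

Definition fps_one : fps F := Fps (fun n => (n == 0%N)%:R).
Definition fps_mul f g : fps F :=
  Fps (fun n => \sum_(i < n.+1) fcoef f i * fcoef g (n - i)).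

(* Up to degree N the product is the product of truncations; the ring laws are
   inherited from {poly F} in this way. *)
Let trunc N f : {poly F} := \poly_(i < N.+1) fcoef f i.

Let coef_trunc N f i : (i <= N)%N -> (trunc N f)`_i = fcoef f i.
Proof. by move=> iN; rewrite coef_poly ltnS iN. Qed.

Let coef_mul N f g i :
  (i <= N)%N -> fcoef (fps_mul f g) i = (trunc N f * trunc N g)`_i.
Proof.
move=> iN; rewrite coefM /=; apply: eq_bigr => -[j /=]; rewrite ltnS => ji _.
by rewrite !coef_trunc ?(leq_trans ji) ?(leq_trans (leq_subr _ _)).
Qed.

Fact fps_mulA : associative fps_mul.
Proof.
move=> f g h; apply/fpsP => n.
transitivity ((trunc n f * (trunc n g * trunc n h))`_n).
  rewrite coefM /=; apply: eq_bigr => -[j /=]; rewrite ltnS => jn _.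
  rewrite coef_trunc //; congr (_ * _).
  exact: (coef_mul g h (leq_subr j n)).
rewrite mulrA coefM /=; apply: eq_bigr => -[j /=]; rewrite ltnS => jn _.
rewrite [in LHS](coef_trunc h (leq_subr _ _)); congr (_ * _).
by symmetry; exact: (coef_mul f g jn).
Qed.

Fact fps_mulC : commutative fps_mul.
Proof.
move=> f g; apply/fpsP => n.
by rewrite !(@coef_mul n) // mulrC.
Qed.

Fact fps_mul1 : left_id fps_one fps_mul.
Proof.
move=> f; apply/fpsP => n /=; rewrite big_ord_recl /= mul1r subn0.
by rewrite big1 ?addr0 // => i _; rewrite mul0r.
Qed.

Fact fps_mulDl : left_distributive fps_mul fps_add.
Proof.
move=> f g h; apply/fpsP => n /=; rewrite -big_split /=.
by apply: eq_bigr => i _; rewrite mulrDl.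
Qed.

Fact fps_one_neq0 : fps_one != fps_zero.
Proof.
by apply/eqP => /fpsP /(_ 0) /= /eqP; rewrite oner_eq0.
Qed.

HB.instance Definition _ := GRing.Zmodule_isComNzRing.Build (fps F)
  fps_mulA fps_mulC fps_mul1 fps_mulDl fps_one_neq0.

Lemma fcoef0 n : fcoef (0 : fps F) n = 0. Proof. by []. Qed.
Lemma fcoefN f n : fcoef (- f) n = - fcoef f n. Proof. by []. Qed.
Lemma fcoefD f g n : fcoef (f + g) n = fcoef f n + fcoef g n.
Proof. by []. Qed.
Lemma fcoef1 n : fcoef (1 : fps F) n = (n == 0%N)%:R. Proof. by []. Qed.
Lemma fcoefM f g n :
  fcoef (f * g) n = \sum_(i < n.+1) fcoef f i * fcoef g (n - i).
Proof. by []. Qed.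

Definition fps_scale (c : F) f : fps F := Fps (fun n => c * fcoef f n).

Fact fps_scaleA a b f : fps_scale a (fps_scale b f) = fps_scale (a * b) f.
Proof. by apply/fpsP => n /=; rewrite mulrA. Qed.
Fact fps_scale1 : left_id 1 fps_scale.
Proof. by move=> f; apply/fpsP => n /=; rewrite mul1r. Qed.
Fact fps_scaleDr : right_distributive fps_scale +%R.
Proof. by move=> a f g; apply/fpsP => n /=; rewrite mulrDr. Qed.
Fact fps_scaleDl f : {morph fps_scale^~ f : a b / a + b}.
Proof. by move=> a b; apply/fpsP => n /=; rewrite mulrDl. Qed.

HB.instance Definition _ := GRing.Zmodule_isLmodule.Build F (fps F)
  fps_scaleA fps_scale1 fps_scaleDr fps_scaleDl.

Lemma fcoefZ c f n : fcoef (c *: f) n = c * fcoef f n. Proof. by []. Qed.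

(* [:: h_0; ...; h_(n-1)], the first coefficients of h = 1 / f, obtained by
   solving f * h = 1 degree by degree. *)
Fixpoint fps_inv_coefs f n : seq F :=
  if n is m.+1 then
    let s := fps_inv_coefs f m in
    rcons s ((fcoef f 0)^-1 *
             ((m == 0%N)%:R - \sum_(i < m) s`_i * fcoef f (m - i)))
  else [::].

Definition fps_unit : {pred fps F} := fun f => fcoef f 0 != 0.
Definition fps_inv f : fps F :=
  if fps_unit f then Fps (fun n => (fps_inv_coefs f n.+1)`_n) else f.

Let size_inv_coefs f n : size (fps_inv_coefs f n) = n.
Proof. by elim: n => //= n IHn; rewrite size_rcons IHn. Qed.

Let nth_inv_coefs f n i :
  (i < n)%N -> (fps_inv_coefs f n)`_i = (fps_inv_coefs f i.+1)`_i.
Proof.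
elim: n => // n IHn; rewrite ltnS leq_eqVlt => /predU1P[-> //|i_n].
by rewrite [LHS]nth_rcons size_inv_coefs i_n IHn.
Qed.

Fact fps_mulVr : {in fps_unit, left_inverse 1 fps_inv *%R}.
Proof.
move=> f Uf; apply/fpsP => n; rewrite fcoefM /fps_inv.
have -> : fps_unit f by [].
rewrite big_ord_recr /= subnn nth_rcons size_inv_coefs ltnn eqxx.
rewrite mulrAC mulVf // mul1r addrC.
under [X in _ - X]eq_bigr => i _ do rewrite nth_inv_coefs //.
by rewrite subrK.
Qed.

Fact fps_unitPl f g : g * f = 1 -> fps_unit f.
Proof.
move=> /fpsP /(_ 0); rewrite fcoefM big_ord1 /= => gf1; apply/eqP => f0.
by move/eqP: gf1; rewrite f0 mulr0 eq_sym oner_eq0.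
Qed.

Fact fps_inv_out : {in [predC fps_unit], fps_inv =1 id}.
Proof. by move=> f /negbTE Uf; rewrite /fps_inv [fps_unit f]Uf. Qed.

HB.instance Definition _ :=
  GRing.ComNzRing_hasMulInverse.Build (fps F) fps_mulVr fps_unitPl fps_inv_out.

Lemma fps_unitE f : (f \is a GRing.unit) = (fcoef f 0 != 0).
Proof. by []. Qed.

Definition fpsX : fps F := Fps (fun n => (n == 1%N)%:R).

(* f / t, for f with zero constant term (see fpsX_divX). *)
Definition fps_divX f : fps F := Fps (fun n => fcoef f n.+1).

Lemma fcoefXM f n :
  fcoef (fpsX * f) n = if n is m.+1 then fcoef f m else 0.
Proof.
rewrite fcoefM; case: n => [|n]; first by rewrite big_ord1 /= mul0r.
rewrite big_ord_recl /= mul0r add0r big_ord_recl /= mul1r subn1 /=.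
by rewrite big1 ?addr0 // => i _; rewrite mul0r.
Qed.

Lemma fpsX_divX f : fcoef f 0 = 0 -> fpsX * fps_divX f = f.
Proof. by move=> f0; apply/fpsP => -[|n]; rewrite fcoefXM ?f0. Qed.

Definition fps_egf (a : nat -> F) : fps F := Fps (fun n => a n / n`!%:R).

(* The sequence whose exponential generating function is f; it is meaningful
   in characteristic 0 only. *)
Definition egf_coef f (n : nat) : F := n`!%:R * fcoef f n.

End FpsRing.

Arguments fpsX {F}.

Definition fall (A : comNzRingType) (x : A) (n : nat) : A :=
  \prod_(i < n) (x - i%:R).

Definition dfall (A : comNzRingType) (lam x : A) (n : nat) : A :=
  \prod_(i < n) (x - i%:R * lam).

(* (1 + t)^x *)
Definition fps_pow1p (F : fieldType) (x : F) : fps F := fps_egf (fall x).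

(* (1 + lam t)^(x / lam) *)
Definition fps_dexp (F : fieldType) (lam x : F) : fps F :=
  fps_egf (dfall lam x).

(* fps_dexp lam x is obtained from (1 + t)^(x / lam) by substituting lam t. *)
Lemma fcoef_dexp (F : fieldType) (lam x : F) n : lam != 0 ->
  fcoef (fps_dexp lam x) n = fcoef (fps_pow1p (x / lam)) n * lam ^+ n.
Proof.
move=> lam0 /=; rewrite mulrAC; congr (_ / _).
have -> : lam ^+ n = \prod_(i < n) lam by rewrite prodr_const card_ord.
rewrite /dfall /fall -big_split /=.
by apply: eq_bigr => i _; rewrite mulrBl divfK.
Qed.

Section Degenerate.
Variable R : realType.
Implicit Types lam x : R.

(* log_lam(1 + t) *)
Definition fps_dlog lam : fps R := lam^-1 *: (fps_pow1p lam - 1).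

Definition daehee_gf lam x : fps R := fps_divX (fps_dlog lam) * fps_pow1p x.

Definition degenerate_daehee (n : nat) lam x : R :=
  egf_coef (daehee_gf lam x) n.

(* t / ((1 + lam t)^(1 / lam) - 1) is the inverse of the invertible series
   ((1 + lam t)^(1 / lam) - 1) / t. *)
Definition bernoulli_gf lam x : fps R :=
  (fps_divX (fps_dexp lam 1 - 1))^-1 * fps_dexp lam x.

Definition degenerate_bernoulli (n : nat) lam x : R :=
  egf_coef (bernoulli_gf lam x) n.

Lemma egf_coefK (f : fps R) : fps_egf (egf_coef f) = f.
Proof.
apply/fpsP => n /=; rewrite /egf_coef mulrAC mulfV ?mul1r //.
by rewrite pnatr_eq0 -lt0n fact_gt0.
Qed.

Lemma degenerate_daeheeE lam x :
  fpsX * fps_egf (fun n => degenerate_daehee n lam x) =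
  fps_dlog lam * fps_pow1p x.
Proof.
rewrite egf_coefK mulrA fpsX_divX // fcoefZ fcoefD fcoefN fcoef1 /=.
by rewrite /fall big_ord0 divr1 subrr mulr0.
Qed.

Lemma degenerate_bernoulliE lam x :
  (fps_dexp lam 1 - 1) * fps_egf (fun n => degenerate_bernoulli n lam x) =
  fpsX * fps_dexp lam x.
Proof.
have e0 : fcoef (fps_dexp lam 1 - 1) 0 = 0.
  by rewrite fcoefD fcoefN /= /dfall big_ord0 divr1 subrr.
rewrite egf_coefK -{1}(fpsX_divX e0) -mulrA; congr (_ * _).
rewrite mulrA divrr ?mul1r // fps_unitE /= /dfall big_ord1.
by rewrite mul0r subr0 divr1 subr0 oner_eq0.
Qed.

Fact degenerate_stirling1_ex lam n : exists s : nat -> R,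
  (forall l, (n < l)%N -> s l = 0) /\
  fall ('X : {poly R}) n = \sum_(l < n.+1) s l *: dfall (lam%:P) 'X l.
Proof.
elim: n => [|n [s [s0 sE]]].
  exists (fun l => (l == 0%N)%:R); split; first by case.
  by rewrite big_ord1 scale1r /fall /dfall !big_ord0.
pose u l : R := if l is k.+1 then s k else 0.
exists (fun l => u l + (l%:R * lam - n%:R) * s l); split=> [[//|l] nl|].
  by rewrite /= !s0 ?mulr0 ?addr0 //; apply: ltnW.
under eq_bigr => l _ do rewrite scalerDl.
rewrite big_split /= big_ord_recl /= scale0r add0r.
rewrite [X in _ + X]big_ord_recr /= s0 // mulr0 scale0r addr0 -big_split /=.
rewrite {1}/fall big_ord_recr /= -/(fall _ n) sE mulr_suml.
apply: eq_bigr => l _; rewrite {2}/dfall big_ord_recr /= -/(dfall _ _ l).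
rewrite -!mul_polyC rmorphM rmorphB rmorphM !rmorph_nat /=.
set d := dfall _ _ _; set c := (s l)%:P.
rewrite [_ * c]mulrC -!mulrA -mulrDr; congr (_ * _).
by rewrite [_ * d]mulrC -mulrDr; congr (_ * _); rewrite addrA subrK.
Qed.

(* The numbers are determined by degenerate_stirling1P and, for n < l, by the
   convention that they vanish (see degenerate_stirling1_uniq). *)
Definition degenerate_stirling1 lam (n l : nat) : R :=
  sval (cid (degenerate_stirling1_ex lam n)) l.

Lemma degenerate_stirling1P lam n :
  fall ('X : {poly R}) n =
  \sum_(l < n.+1) degenerate_stirling1 lam n l *: dfall (lam%:P) 'X l.
Proof. by rewrite /degenerate_stirling1; case: cid => s []. Qed.

Lemma degenerate_stirling1_small lam n l :
  (n < l)%N -> degenerate_stirling1 lam n l = 0.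
Proof. by rewrite /degenerate_stirling1; case: cid => s [/= s0 _]; exact: s0. Qed.

Lemma degenerate_stirling1_uniq lam n (s : nat -> R) :
  fall ('X : {poly R}) n = \sum_(l < n.+1) s l *: dfall (lam%:P) 'X l ->
  forall l, (l <= n)%N -> s l = degenerate_stirling1 lam n l.
Proof.
have sz k : size (dfall (lam%:P) ('X : {poly R}) k) = k.+1.
  rewrite /dfall; under eq_bigr => i _ do rewrite -polyC_natr -polyCM.
  by rewrite size_prod_XsubC /index_enum -enumT size_enum_ord.
suff free m (c : nat -> R) :
    \sum_(l < m) c l *: dfall (lam%:P) ('X : {poly R}) l = 0 ->
    forall l, (l < m)%N -> c l = 0.
  move=> sE l ln; apply/eqP; rewrite -subr_eq0; apply/eqP.
  apply: (free n.+1 (fun l => s l - degenerate_stirling1 lam n l)) => //.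
  under eq_bigr => i _ do rewrite scalerBl.
  by rewrite sumrB -sE -degenerate_stirling1P subrr.
elim: m c => // m IHm c; rewrite big_ord_recr /= => c0.
have cm : c m = 0.
  apply/eqP/negPn/negP => cm.
  pose p : {poly R} := \sum_(l < m) c l *: dfall (lam%:P) 'X l.
  have: (size p <= m)%N.
    apply: (leq_trans (size_sum _ _ _)); apply/bigmax_leqP => i _.
    by apply: (leq_trans (size_scale_leq _ _)); rewrite sz.
  move/eqP: c0; rewrite addr_eq0 -/p => /eqP ->.
  by rewrite size_polyN size_scale // sz ltnn.
move=> l; rewrite ltnS leq_eqVlt => /predU1P[-> //|lm].
by apply: (IHm c) => //; move: c0; rewrite cm scale0r addr0.
Qed.

End Degenerate.

(* Main.v *)
From HB Require Import structures.
Require Import Defs.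
From mathcomp Require Import all_boot all_order all_algebra.
From mathcomp Require Import boolp reals.
From mathcomp Require Import ring.

Set Implicit Arguments.
Unset Strict Implicit.
Unset Printing Implicit Defensive.

Import Order.TTheory GRing.Theory Num.Theory.
Local Open Scope ring_scope.

(** The substitution [t := log_lam(1 + t)] is a ring endomorphism [T] of the
    power series. It sends [(1 + lam t)^(x / lam)] to [(1 + t)^x], and [t] to
    [log_lam(1 + t)]. Applied to the equation that defines the Bernoulli series
    [B], namely [((1 + lam t)^(1 / lam) - 1) B = t (1 + lam t)^(x / lam)], it
    gives [t T(B) = log_lam(1 + t) (1 + t)^x]; the Daehee series satisfies the
    same equation, hence equals [T(B)] after cancelling [t].

    Composition of series is avoided: [T] is defined on coefficients by the
    matrix of degenerate Stirling numbers ([dlog_subst]), so that comparing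
    coefficients in [D = T(B)] is the wanted formula, and the definition of
    these numbers says at once that [T] sends [(1 + lam t)^(x / lam)] to
    [(1 + t)^x] ([dlog_subst_dexp]). What is left is the multiplicativity of [T]
    ([dlog_substM]). On the series [(1 + lam t)^(x / lam)] it follows from
    the law of exponents ([fps_dexpD], the Chu-Vandermonde identity), and these
    series are dense in the sense that a linear map acting continuously on
    coefficients vanishes as soon as it kills them all ([dexp_dense]). *)

(** * Coefficients of power series *)

Lemma fcoef_sum (F : fieldType) (I : Type) (r : seq I) (P : pred I)
    (f : I -> fps F) n :
  fcoef (\sum_(i <- r | P i) f i) n = \sum_(i <- r | P i) fcoef (f i) n.
Proof. exact: (big_morph (fun f => fcoef f n) (fun f g => fcoefD f g n)). Qed.

Lemma fps_scalerAl (F : fieldType) (c : F) (f g : fps F) :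
  c *: (f * g) = c *: f * g.
Proof.
apply/fpsP => n; rewrite fcoefZ !fcoefM mulr_sumr.
by apply: eq_bigr => i _; rewrite fcoefZ mulrA.
Qed.

Lemma fpsX_inj (F : fieldType) : injective ( *%R (@fpsX F)).
Proof.
by move=> f g /fpsP fg; apply/fpsP => n; have := fg n.+1; rewrite !fcoefXM.
Qed.

Lemma natr_fact_neq0 (F : numFieldType) n : n`!%:R != 0 :> F.
Proof. by rewrite pnatr_eq0 -lt0n fact_gt0. Qed.

Lemma egf_coef_egf (F : numFieldType) (a : nat -> F) n :
  egf_coef (fps_egf a) n = a n.
Proof. by rewrite /egf_coef /= mulrC divfK ?natr_fact_neq0. Qed.

Definition fps_low0 (F : fieldType) (n : nat) (f : fps F) : Prop :=
  forall i, (i <= n)%N -> fcoef f i = 0.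

Lemma fps_low0M (F : fieldType) n (f g : fps F) :
  fps_low0 n f -> fps_low0 n (f * g).
Proof.
move=> f0 i le_in; rewrite fcoefM big1 // => -[j /=]; rewrite ltnS => le_ji _.
by rewrite f0 ?mul0r // (leq_trans le_ji).
Qed.

(** * The series (1 + lam t)^(x / lam) *)

Section DegenerateExponential.
Variable F : numFieldType.
Implicit Types (lam x y : F) (f : fps F).

Lemma dfall0 (A : comNzRingType) (lam x : A) : dfall lam x 0 = 1.
Proof. by rewrite /dfall big_ord0. Qed.

Lemma dfallS (A : comNzRingType) (lam x : A) n :
  dfall lam x n.+1 = dfall lam x n * (x - n%:R * lam).
Proof. by rewrite /dfall big_ord_recr. Qed.

Lemma fall_dfall1 (A : comNzRingType) (x : A) n : fall x n = dfall 1 x n.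
Proof. by apply: eq_bigr => i _; rewrite mulr1. Qed.

Lemma fps_pow1pE x : fps_pow1p x = fps_dexp 1 x.
Proof. by apply/fpsP => n /=; rewrite fall_dfall1. Qed.

Lemma fcoef_dexp0 lam x : fcoef (fps_dexp lam x) 0 = 1.
Proof. by rewrite /= dfall0 divr1. Qed.

(** This is the differential equation [(1 + lam t) f' = x f]. *)
Lemma fcoef_dexpS lam x n :
  n.+1%:R * fcoef (fps_dexp lam x) n.+1 =
  (x - n%:R * lam) * fcoef (fps_dexp lam x) n.
Proof.
rewrite /= dfallS factS natrM invfM [LHS]mulrCA mulVKf ?pnatr_eq0 //.
by rewrite mulrAC mulrC.
Qed.

(** Both sides have constant term [1] and satisfy the differential equation
    with exponent [x + y]. *)
Lemma fps_dexpD lam x y :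
  fps_dexp lam (x + y) = fps_dexp lam x * fps_dexp lam y.
Proof.
apply/fpsP; elim=> [|n IHn].
  by rewrite fcoefM big_ord1 !fcoef_dexp0 mulr1.
apply: (@mulfI _ n.+1%:R); first by rewrite pnatr_eq0.
rewrite fcoef_dexpS IHn !fcoefM.
set f := fcoef (fps_dexp lam x); set g := fcoef (fps_dexp lam y).
(* Leibniz rule: the weight n + 1 is split as i + (n + 1 - i) *)
transitivity (\sum_(i < n.+2) (i%:R * f i) * g (n.+1 - i)%N +
              \sum_(i < n.+2) f i * ((n.+1 - i)%:R * g (n.+1 - i)%N)).
  rewrite [X in _ = X + _]big_ord_recl /= mul0r mul0r add0r.
  rewrite [X in _ = _ + X]big_ord_recr /= subnn mul0r mulr0 addr0 -big_split /=.
  rewrite mulr_sumr; apply: eq_bigr => -[i /=]; rewrite ltnS => le_in _.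
  rewrite subSS subSn // /f /g !fcoef_dexpS (natrB _ le_in) -/f -/g.
  ring.
rewrite -big_split mulr_sumr /=; apply: eq_bigr => -[i /=].
by rewrite ltnS => le_in _; rewrite (natrB _ le_in); ring.
Qed.

Lemma fps_dexp0 lam : fps_dexp lam 0 = 1.
Proof.
apply/fpsP; case=> [|n]; first by rewrite fcoef_dexp0.
by rewrite fcoef1 /= /dfall big_ord_recl mul0r subr0 !mul0r.
Qed.

(** A first power: the factor [x - lam] vanishes for [x = lam]. *)
Lemma fps_dexp_lam lam : fps_dexp lam lam = 1 + lam *: fpsX.
Proof.
apply/fpsP => n; rewrite fcoefD fcoefZ fcoef1 /= /dfall.
case: n => [|[|n]] /=.
- by rewrite big_ord0 divr1 mulr0 addr0.
- by rewrite big_ord1 mul0r subr0 divr1 mulr1 add0r.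
by rewrite !big_ord_recl /= mul1r subrr !(mul0r, mulr0, addr0).
Qed.

Lemma dfall_mul_lam lam k n :
  dfall lam (k%:R * lam) n = (k ^_ n)%:R * lam ^+ n.
Proof.
elim: n => [|n IHn]; first by rewrite dfall0 ffactn0 mulr1.
rewrite dfallS IHn ffactnSr natrM exprSr.
have [le_nk|lt_kn] := leqP n k; first by rewrite natrB //; ring.
by rewrite ffact_small // !mul0r.
Qed.

(** Evaluation at the points [k lam] is triangular, since
    [(k lam)_(i, lam) = 0] for [k < i]. *)
Lemma dfall_free lam (c : nat -> F) n : lam != 0 ->
    (forall x, \sum_(i < n.+1) c i * dfall lam x i = 0) ->
  forall i, (i <= n)%N -> c i = 0.
Proof.
move=> lam0 c0; elim/ltn_ind=> k IHk le_kn.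
have := c0 (k%:R * lam); rewrite (bigD1 (Ordinal (le_kn : (k < n.+1)%N))) //=.
rewrite big1 ?addr0 => [/eqP|i /negP neq_ik].
  rewrite dfall_mul_lam ffactnn !mulf_eq0 expf_eq0 (negbTE lam0) andbF.
  by rewrite (negbTE (natr_fact_neq0 _ _)) !orbF => /eqP.
rewrite dfall_mul_lam; case: (ltngtP i k) => [lt_ik|lt_ki|eq_ik].
- by rewrite IHk ?mul0r // -ltnS.
- by rewrite ffact_small // !(mul0r, mulr0).
by case: neq_ik; apply/eqP/val_inj.
Qed.

(** The second hypothesis on [A] is continuity: the coefficients of [A f] up to
    degree [n] depend only on those of [f], which reduces the claim to the
    finitely many monomials of degree at most [n] and thus to the linear
    independence of the degenerate falling factorials. *)
Lemma dexp_dense lam (A : fps F -> fps F) : lam != 0 ->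
    linear A -> (forall n f, fps_low0 n f -> fps_low0 n (A f)) ->
    (forall x, A (fps_dexp lam x) = 0) ->
  forall f, A f = 0.
Proof.
move=> lam0 linA contA A0 f; apply/fpsP => n; rewrite fcoef0.
pose mono i : fps F := Fps (fun j => (j == i)%:R).
pose c i := fcoef (A (mono i)) n.
have Ac g : fcoef (A g) n = \sum_(i < n.+1) fcoef g i * c i.
  pose p := \sum_(i < n.+1) fcoef g i *: mono i.
  have Ap : A p = \sum_(i < n.+1) fcoef g i *: A (mono i).
    rewrite /p; elim/big_rec2: _ => [|i u v _ <-]; last exact: linA.
    by have := linA (-1) 0 0; rewrite !scaleN1r !addNr.
  have low0 : fps_low0 n (g - p).
    move=> i le_in; rewrite fcoefD fcoefN fcoef_sum.
    rewrite (bigD1 (Ordinal (le_in : (i < n.+1)%N))) //= eqxx mulr1 big1.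
      by rewrite addr0 subrr.
    by move=> j /negbTE; rewrite -val_eqE /= eq_sym => ->; rewrite mulr0.
  have -> : A g = A (g - p) + A p.
    by have := linA 1 (g - p) p; rewrite !scale1r subrK.
  by rewrite fcoefD (contA _ _ low0) // add0r Ap fcoef_sum.
rewrite Ac big1 // => -[i /=]; rewrite ltnS => le_in _.
suff: c i / i`!%:R = 0.
  by move=> /eqP; rewrite mulf_eq0 invr_eq0 (negbTE (natr_fact_neq0 _ _)) orbF
    => /eqP ->; rewrite mulr0.
apply: (dfall_free lam0 (c := fun i => c i / i`!%:R)) le_in => x.
have := Ac (fps_dexp lam x); rewrite A0 fcoef0 => sum0; rewrite [RHS]sum0.
by apply: eq_bigr => j _ /=; rewrite mulrC mulrCA mulrC.
Qed.

End DegenerateExponential.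

(** * Substituting the degenerate logarithm *)

Section DegenerateLogarithm.
Variables (R : realType) (lam : R).
Implicit Types (x y : R) (f g : fps R).

(** For nonzero [lam] this is [f(log_lam(1 + t))], because the exponential
    generating function of [n |-> S_(1,lam)(n, m)] is
    [log_lam(1 + t)^m / m!]. *)
Definition dlog_subst f : fps R :=
  fps_egf (fun n =>
    \sum_(m < n.+1) egf_coef f m * degenerate_stirling1 lam n m).

Lemma dlog_subst_linear : linear dlog_subst.
Proof.
move=> c f g; apply/fpsP => n; rewrite fcoefD fcoefZ /= mulrA -mulrDl.
congr (_ / _); rewrite mulr_sumr -big_split /=; apply: eq_bigr => m _.
by rewrite /egf_coef fcoefD fcoefZ; ring.
Qed.

HB.instance Definition _ :=
  GRing.isLinear.Build R (fps R) (fps R) _ dlog_subst dlog_subst_linear.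

Lemma dlog_subst_low0 n f : fps_low0 n f -> fps_low0 n (dlog_subst f).
Proof.
move=> f0 i le_in; rewrite /= big1 ?mul0r // => -[m /=]; rewrite ltnS => le_mi _.
by rewrite /egf_coef f0 ?mulr0 ?mul0r // (leq_trans le_mi).
Qed.

Lemma dlog_subst_dexp x : dlog_subst (fps_dexp lam x) = fps_pow1p x.
Proof.
apply/fpsP => n /=; congr (_ / _).
have := congr1 (horner_eval x) (degenerate_stirling1P lam n).
rewrite /horner_eval horner_sum /fall horner_prod.
under eq_bigr => i _ do rewrite hornerD hornerN hornerX -polyC_natr hornerC.
move=> ->; apply: eq_bigr => m _; rewrite egf_coef_egf hornerZ mulrC.
congr (_ * _); rewrite /dfall horner_prod; apply: eq_bigr => i _.
by rewrite hornerD hornerN hornerX -polyC_natr -polyCM hornerC.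
Qed.

Lemma dlog_subst1 : dlog_subst 1 = 1.
Proof. by rewrite -(fps_dexp0 lam) dlog_subst_dexp fps_pow1pE !fps_dexp0. Qed.

Hypothesis lam_neq0 : lam != 0.

(** The defect [T(f g) - T(f) T(g)] is linear and continuous in each argument,
    so by density it is enough to see it vanish on the degenerate
    exponentials. *)
Lemma dlog_substM f g : dlog_subst (f * g) = dlog_subst f * dlog_subst g.
Proof.
have dense h : (forall y, dlog_subst (fps_dexp lam y * h) =
    dlog_subst (fps_dexp lam y) * dlog_subst h) ->
    forall u, dlog_subst (u * h) = dlog_subst u * dlog_subst h.
  move=> dexpM u; apply/eqP; rewrite -subr_eq0; apply/eqP; move: u.
  apply: (dexp_dense lam_neq0).
  - move=> c u v; rewrite mulrDl -fps_scalerAl !linearP mulrDl -fps_scalerAl.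
    by rewrite scalerBr addrACA opprD.
  - move=> n u u0 i le_in; rewrite fcoefD fcoefN.
    rewrite (dlog_subst_low0 (fps_low0M h u0)) //.
    by rewrite (fps_low0M _ (dlog_subst_low0 u0)) // subrr.
  by move=> y; rewrite dexpM subrr.
apply: (dense) => y; rewrite mulrC [RHS]mulrC; apply: (dense) => x.
by rewrite -fps_dexpD !dlog_subst_dexp !fps_pow1pE fps_dexpD.
Qed.

(** The series [1 + lam t] is the degenerate exponential at [x = lam], so its
    image [(1 + t)^lam] is known. *)
Lemma dlog_substX : dlog_subst fpsX = fps_dlog lam.
Proof.
have -> : fpsX = lam^-1 *: (fps_dexp lam lam - 1).
  by rewrite fps_dexp_lam addrC addKr scalerA mulVf // scale1r.
by rewrite linearZ linearB /= dlog_subst_dexp dlog_subst1.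
Qed.

Lemma dlog_subst_bernoulli x : dlog_subst (bernoulli_gf lam x) = daehee_gf lam x.
Proof.
apply: fpsX_inj.
have := congr1 dlog_subst (degenerate_bernoulliE lam x).
have := degenerate_daeheeE lam x.
rewrite !egf_coefK => -> .
rewrite !dlog_substM dlog_substX linearB /= !dlog_subst_dexp dlog_subst1 => <-.
(* (1 + t)^1 - 1 = t *)
by rewrite (fps_pow1pE 1) fps_dexp_lam scale1r [1 + fpsX]addrC addrK.
Qed.

End DegenerateLogarithm.

Theorem theorem2p3 (R : realType) (lam x : R) (hlam : lam != 0) (n : nat) :
  degenerate_daehee n lam x =
  \sum_(0 <= m < n.+1) degenerate_bernoulli m lam x * degenerate_stirling1 lam n m.
Proof.
rewrite big_mkord /degenerate_daehee -dlog_subst_bernoulli //.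
exact: egf_coef_egf.
Qed.
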